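(* Let $p$ be an even positive definite form in the variables $x=(x_1,\ldots,x_n)$ with real coefficients. Then there exists an integer $r\ge 0$ for which $p$ is r-dsos (and hence r-sdsos).
   Context: A form is a homogeneous polynomial, i.e. one whose monomials all have the same degree. A form $p$ is positive definite if $p(x)>0$ for all $x\in\mathbb{R}^n$, $x\neq 0$. A polynomial is even if in each of its monomials every individual variable is raised only to an even degree. A monomial in $x=(x_1,\ldots,x_n)$ is a function $m(x)=x_1^{\alpha_1}\cdots x_n^{\alpha_n}$ with each $\alpha_i$ a nonnegative integer. A polynomial $q$ is dsos if it can be written as $$q(x)=\sum_i \alpha_i m_i^2(x) + \sum_{i,j} \beta_{ij}^+ (m_i(x)+ m_j(x))^2+ \sum_{i,j} \beta_{ij}^- (m_i(x)- m_j(x))^2$$ (finite sums) for some monomials $m_i, m_j$ and some nonnegative scalars $\alpha_i,\beta_{ij}^+, \beta_{ij}^-$. It is sdsos if it can be written as $$q(x)=\sum_i \alpha_i m_i^2(x) + \sum_{i,j} (\hat{\beta}_{ij}^+ m_i(x)+ \tilde{\beta}_{ij}^+ m_j(x))^2+\sum_{i,j} (\hat{\beta}_{ij}^- m_i(x)- \tilde{\beta}_{ij}^- m_j(x))^2$$ (finite sums) for some monomials $m_i, m_j$ and some real scalars $\alpha_i, \hat{\beta}_{ij}^+, \tilde{\beta}_{ij}^+, \hat{\beta}_{ij}^-, \tilde{\beta}_{ij}^-$ with $\alpha_i \geq 0$. For an integer $r\geq 0$, a polynomial $p(x_1,\ldots,x_n)$ is r-dsos (resp. r-sdsos) if $p(x)\cdot(\sum_{i=1}^n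 x_i^2)^r$ is dsos (resp. sdsos). *)

(* Defs.v *)
From mathcomp Require Import all_boot all_order all_algebra.
From mathcomp Require Import reals.
From mathcomp Require Import mpoly.

Set Implicit Arguments.
Unset Strict Implicit.
Unset Printing Implicit Defensive.

Import GRing.Theory Num.Theory.
Local Open Scope ring_scope.

Section Polynomials.
Context {R : realType} {n : nat}.
Implicit Types (p q : {mpoly R[n]}) (r : nat).

Definition is_form p : Prop := exists d : nat, p \is d.-homog.

Definition pos_def p : Prop :=
  forall x : 'rV[R]_n, x != 0 -> 0 < p.@[x ord0].

Definition even_mpoly p : Prop :=
  forall m : 'X_{1..n}, m \in msupp p -> forall i : 'I_n, ~~ odd (m i).

(* The family m lists the finitely many monomials occurring in any of the three
   sums; a term absent from a sum has zero coefficients. *)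
Definition dsos q : Prop :=
  exists (k : nat) (m : 'I_k -> 'X_{1..n})
         (alpha : 'I_k -> R) (betap betam : 'I_k -> 'I_k -> R),
  [/\ forall i, 0 <= alpha i,
      forall i j, 0 <= betap i j,
      forall i j, 0 <= betam i j
    & q = \sum_(i < k) alpha i *: 'X_[m i] ^+ 2
        + \sum_(i < k) \sum_(j < k) betap i j *: ('X_[m i] + 'X_[m j]) ^+ 2
        + \sum_(i < k) \sum_(j < k) betam i j *: ('X_[m i] - 'X_[m j]) ^+ 2].

Definition sdsos q : Prop :=
  exists (k : nat) (m : 'I_k -> 'X_{1..n}) (alpha : 'I_k -> R)
         (bhatp btildep bhatm btildem : 'I_k -> 'I_k -> R),
  (forall i, 0 <= alpha i) /\
  q = \sum_(i < k) alpha i *: 'X_[m i] ^+ 2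
    + \sum_(i < k) \sum_(j < k)
        (bhatp i j *: 'X_[m i] + btildep i j *: 'X_[m j]) ^+ 2
    + \sum_(i < k) \sum_(j < k)
        (bhatm i j *: 'X_[m i] - btildem i j *: 'X_[m j]) ^+ 2.

Definition r_dsos r p : Prop := dsos (p * (\sum_(i < n) 'X_i ^+ 2) ^+ r).

Definition r_sdsos r p : Prop := sdsos (p * (\sum_(i < n) 'X_i ^+ 2) ^+ r).

End Polynomials.

(* Main.v *)
Require Import Defs.
From mathcomp Require Import all_boot all_order all_algebra.
From mathcomp Require Import reals.
From mathcomp Require Import mpoly.
From mathcomp Require Import ring zify.
From mathcomp Require boolp classical_sets functions topology normedtype.

(** An even form in $x$ is a form $f$ in the squares: $p = f(x_1^2,...,x_n^2)$,
and positive definiteness of $p$ says that $f > 0$ on the simplex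
$x_i >= 0$, $x_1 + ... + x_n = 1$, since $f(x)$ is the value of $p$ at
the nonzero point $(sqrt x_1,...,sqrt x_n)$.  By Polya's theorem ([polya])
some $g = f (x_1 + ... + x_n)^r$ has only nonnegative coefficients.  Substituting
the squares back, $p (x_1^2 + ... + x_n^2)^r = g(x_1^2,...,x_n^2)$ is a
nonnegative combination of squares of monomials: it is dsos and sdsos
with all binomial terms zero.

Polya's theorem is proved by computing coefficients.  Let $d$ be the degree of
$f$, and $b$ an exponent of total degree $M = d + r$.  By the multinomial
formula ([mcoeff_sumX_exp], [mcoeff_mpolyX_sumX_exp]) the coefficient of $g$ at
$b$, times $b_1! ... b_n!$, is $r!$ times
$sum_m f_m prod_i b_i (b_i - 1) ... (b_i - m_i + 1)$.
With $y = b / M$, a point of the simplex, that sum is $M^d$ times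
$sum_m f_m prod_i prod_{k < m_i} (y_i - k / M)$,
a perturbation of $f(y)$ that tends to it as $M$ grows.  As the simplex is
compact and $f > 0$ there, these sums are positive at all its points at
once when $M$ is large ([eventually_pos_on_simplex]).

For $n = 0$ the simplex is empty and $f$ may be a negative constant; the
exponent $r$ is chosen positive, so that $g = 0$ then. *)

(** * Uniform positivity on the simplex *)

Module Compactness.
Import boolp classical_sets functions reals topology normedtype.
Import numFieldNormedType.Exports.
Import Order.TTheory GRing.Theory Num.Theory.
Local Open Scope classical_set_scope.
Local Open Scope ring_scope.

Lemma cvg_bigsum (K : numFieldType) (T I : Type) (F : set_system T)
    {FF : Filter F} (s : seq I) (g : I -> T -> K) (l : I -> K) :
  (forall i, g i x @[x --> F] --> l i) ->
  \sum_(i <- s) g i x @[x --> F] --> \sum_(i <- s) l i.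
Proof. by move=> gl; apply: cvg_big => //; exact: add_continuous. Qed.

Lemma cvg_bigprod (K : numFieldType) (T I : Type) (F : set_system T)
    {FF : Filter F} (s : seq I) (g : I -> T -> K) (l : I -> K) :
  (forall i, g i x @[x --> F] --> l i) ->
  \prod_(i <- s) g i x @[x --> F] --> \prod_(i <- s) l i.
Proof. by move=> gl; apply: cvg_big => //; exact: mul_continuous. Qed.

Lemma simplex_compact (R : realType) (n : nat) :
  compact [set x : 'rV[R]_n | (forall i, 0 <= x ord0 i)
                              /\ \sum_i x ord0 i = 1].
Proof.
have box : compact [set x : 'rV[R]_n | forall i, `[0, 1]%classic (x ord0 i)].
  apply: (@rV_compact R n (fun=> `[0, 1]%classic)) => i.
  exact: segment_compact.
have clsum : closed [set x : 'rV[R]_n | \sum_i x ord0 i = 1].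
  apply: (@preimage_closed _ _ (fun x : 'rV[R]_n => \sum_i x ord0 i) [set 1]).
    move=> x _; apply: (@cvg_bigsum _ _ _ (nbhs x)) => i.
    exact: coord_continuous.
  exact: closed_eq.
have := compact_closedI box clsum; congr compact; apply/seteqP; split => x /=.
  by move=> [xi x1]; split => // i; have := xi i; rewrite in_itv/= => /andP[].
move=> [xi x1]; split=> // i; rewrite in_itv/= xi/= -x1 (bigD1 i)//= lerDl.
by rewrite sumr_ge0.
Qed.

(** Each sum converges to its unperturbed value as $(x, M)$ tends to
$(x_0, infinity)$ jointly; compactness of the simplex, in the form
[near_covering], turns this local statement into one bound on $M$ valid for
all $x$ without any explicit estimate. *)
Lemma eventually_pos_on_simplex (R : realType) (n : nat) (T : Type)
    (s : seq T) (c : T -> R) (a : T -> 'I_n -> nat) :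
  (forall x : 'I_n -> R, (forall i, 0 <= x i) -> \sum_i x i = 1 ->
     0 < \sum_(t <- s) c t * \prod_i x i ^+ a t i) ->
  exists N : nat, forall M : nat, (N <= M)%N ->
    forall x : 'I_n -> R, (forall i, 0 <= x i) -> \sum_i x i = 1 ->
      0 < \sum_(t <- s) c t * \prod_i \prod_(k < a t i) (x i - k%:R / M%:R).
Proof.
move=> pos.
pose G (M : nat) (x : 'rV[R]_n) : R :=
  \sum_(t <- s) c t * \prod_i \prod_(k < a t i) (x ord0 i - k%:R / M%:R).
have /compact_near_coveringP cov := @simplex_compact R n.
have := cov nat \oo (fun M x => 0 < G M x) _.
case=> [x [x0 x1]|N _ NG].
  have Gx : G z.2 z.1 @[z --> (x, \oo)] -->
      \sum_(t <- s) c t * \prod_i x ord0 i ^+ a t i.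
    apply: cvg_bigsum => t; apply: cvgM; first exact: cvg_cst.
    apply: cvg_bigprod => i.
    (* x^a is the product of a copies of x, the limits of the a factors *)
    rewrite -[in X in _ --> X](card_ord (a t i)) -prodr_const.
    apply: cvg_bigprod => k; rewrite -[X in _ --> X]subr0; apply: cvgB.
      apply: (@cvg_comp _ _ _ fst (fun y : 'rV[R]_n => y ord0 i) _ (nbhs x)).
        exact: cvg_fst.
      exact: coord_continuous.
    rewrite -(mulr0 (k%:R : R)); apply: cvgM; first exact: cvg_cst.
    apply: (@cvg_comp _ _ _ snd (fun M : nat => M%:R^-1 : R) _ \oo).
      exact: cvg_snd.
    apply/gtr0_cvgV0; last exact: cvgr_idn.
    by near=> M; rewrite ltr0n; near: M; exact: nbhs_infty_gt.
  exact: (cvgr_gt _ Gx _ (pos _ x0 x1)).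
exists N => M NM x x0 x1.
have := NG M NM (\row_i x i); rewrite /G.
have rowE i : (\row_i x i) ord0 i = x i by rewrite mxE.
under eq_bigr do under eq_bigr do under eq_bigr do rewrite rowE.
by apply; split=> [i|]; [rewrite rowE | under eq_bigr do rewrite rowE].
Unshelve. all: end_near. Qed.
End Compactness.

Local Open Scope ring_scope.
Import Order.TTheory GRing.Theory Num.Theory.

(** * Coefficients of a monomial times a power of the sum of the variables *)

(** The multinomial formula, with the division by the product of the $m_i!$
cleared so that it holds over any commutative ring.  Differentiating by a
variable that occurs in $m$ turns $S^{r+1}$ into $(r + 1) S^r$, where $S$ is the
sum of the variables, which gives an induction on the degree. *)
Lemma mcoeff_sumX_exp (R : comNzRingType) (n : nat) (m : 'X_{1..n}) :
  (\prod_(i < n) (m i)`!)%:R * ((\sum_(i < n) 'X_i : {mpoly R[n]}) ^+ mdeg m)@_m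
  = ((mdeg m)`!)%:R.
Proof.
move: {2}(mdeg m) (erefl (mdeg m)) => r.
elim: r m => [|r IHr] m degm; rewrite degm.
  have /eqP -> : (m == 0)%MM by rewrite -mdeg_eq0 degm.
  by rewrite expr0 mcoeff1 eqxx mulr1 big1 // => i _; rewrite mnm0E.
have [i mi] : exists i, (0 < m i)%N.
  apply/existsP; apply: contra_eqT degm; rewrite negb_exists => /forallP m0.
  by rewrite mdegE big1 // => i _; have := m0 i; lia.
pose m' := (m - U_(i))%MM.
have mE : m = (m' + U_(i))%MM by rewrite submK // lep1mP -lt0n.
have degm' : mdeg m' = r by move: degm; rewrite mE mdegD mdeg1; lia.
have dS k : (((\sum_(i < n) 'X_i : {mpoly R[n]}) ^+ k.+1)^`M(i))
    = (\sum_(i < n) 'X_i) ^+ k *+ k.+1.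
  have d1 : (\sum_(i < n) 'X_i : {mpoly R[n]})^`M(i) = 1.
    rewrite linear_sum (bigD1 i) //= big1 ?addr0 => [|j ji].
      by rewrite mderivX mnm1E eqxx scale1r -{1}[U_(i)%MM]add0m addmK mpolyX0.
    by rewrite mderivX mnm1E (negbTE ji) scale0r.
  elim: k => [|k IHk]; first by rewrite expr1 expr0 d1.
  by rewrite exprS mderivM d1 mul1r IHk mulrnAr -exprS -mulrS.
have -> : (\prod_(j < n) (m j)`! = (m' i).+1 * \prod_(j < n) (m' j)`!)%N.
  rewrite (bigD1 i) //= [in RHS](bigD1 i) //= mulnA -factS.
  congr (_ * _)%N; first by rewrite [in LHS]mE mnmDE mnm1E eqxx addn1.
  apply: eq_bigr => j ji.
  by rewrite [in LHS]mE mnmDE mnm1E eq_sym (negbTE ji) addn0.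
rewrite natrM mulrAC [X in X * _]mulr_natl {1}mE -mcoeff_mderiv dS mcoeffMn.
by rewrite mulrC mulrnAr -{1}degm' IHr // degm' factS natrM mulr_natl.
Qed.

(** With $S$ the sum of the variables, the coefficient is that of $S^r$ at
$b - m$, and $b_i! / (b_i - m_i)!$
is a falling factorial.  When $m$ does not divide $b$, the coefficient is zero
and so is one of the falling factorials, so that no case distinction survives
in the formula. *)
Lemma mcoeff_mpolyX_sumX_exp (R : comNzRingType) (n r : nat) (m b : 'X_{1..n}) :
  mdeg b = (mdeg m + r)%N ->
  (\prod_(i < n) (b i)`!)%:R *
    ('X_[m] * (\sum_(i < n) 'X_i : {mpoly R[n]}) ^+ r)@_b
  = (r`! * \prod_(i < n) (b i) ^_ (m i))%:R.
Proof.
move=> degb; rewrite -commr_mpolyX; have [mb|/mnm_lepP nmb] := boolP (m <= b)%MM.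
  have bE : b = (m + (b - m))%MM by rewrite addmC submK.
  have rE : r = mdeg (b - m)%MM by move: degb; rewrite {1}bE mdegD; lia.
  have := @mcoeff_sumX_exp R n (b - m)%MM; rewrite -rE natrM => <-.
  rewrite {2}bE mcoeffMX mulrAC -natrM; congr (_%:R * _); rewrite -big_split /=.
  by apply: eq_bigr => i _; rewrite mnmBE mulnC ffact_fact //; apply/mnm_lepP.
have [i bi] : exists i, (b i < m i)%N.
  apply/existsP; apply: contraT; rewrite negb_exists => /forallP h.
  by case: nmb => i; rewrite leqNgt; apply: h.
rewrite [in RHS](bigD1 i) //= ffact_small // mul0n muln0.
rewrite memN_msupp_eq0 ?mulr0 // (perm_mem (msuppMX _ _)).
apply/mapP => -[k _ bE]; move: bi; rewrite bE mnmDE; lia.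
Qed.

(** A falling factorial as a perturbed power of $b / M$.  For $a > b$ both sides
vanish, the right one because of the factor $k = b$: truncated subtraction
does no harm. *)
Lemma natr_ffact (F : numFieldType) (M b a : nat) : (0 < M)%N ->
  (b ^_ a)%:R = M%:R ^+ a * \prod_(k < a) (b%:R / M%:R - k%:R / M%:R) :> F.
Proof.
move=> M0; have nzM : M%:R != 0 :> F by rewrite pnatr_eq0 -lt0n.
elim: a => [|a IHa]; first by rewrite big_ord0 ffactn0 expr0 mulr1.
rewrite ffactnSr big_ord_recr /= exprSr natrM IHa.
have [ab|ba] := leqP a b; first by rewrite natrB //; field.
have -> : \prod_(k < a) (b%:R / M%:R - k%:R / M%:R) = 0 :> F.
  by rewrite (bigD1 (Ordinal ba)) //= subrr mul0r.
by rewrite !(mul0r, mulr0).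
Qed.

(** * Polya's theorem *)

Theorem polya (R : realType) (n d : nat) (f : {mpoly R[n]}) :
  f \is d.-homog ->
  (forall x : 'I_n -> R, (forall i, 0 <= x i) -> \sum_i x i = 1 -> 0 < f.@[x]) ->
  exists r : nat, forall b, 0 <= (f * (\sum_(i < n) 'X_i) ^+ r)@_b.
Proof.
move=> fhom fpos.
have [|N NP] := @Compactness.eventually_pos_on_simplex R n _ (msupp f)
   (fun m => f@_m) (fun m i => m i).
  by move=> x x0 x1; rewrite -mevalE; apply: fpos.
(* positive even for N = 0, so that M > 0 and b / M is a point of the simplex *)
exists N.+1 => b; set S := \sum_(i < n) _.
have [degb|degb] := eqVneq (mdeg b) (d + N.+1)%N; last first.
  have Shom : S \is 1.-homog by apply: rpred_sum => i _; rewrite dhomogX /= mdeg1.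
  have hom : f * S ^+ N.+1 \is (d + N.+1).-homog.
    by apply: dhomogM => //; rewrite -[X in X.-homog]mul1n; apply: dhomogMn.
  by rewrite (dhomog_nemf_coeff hom degb).
set M := (d + N.+1)%N in degb.
have M0 : (0 < M)%N by rewrite /M; lia.
have nzM : M%:R != 0 :> R by rewrite pnatr_eq0 -lt0n.
have b0 : 0 < (\prod_(i < n) (b i)`!)%:R :> R.
  by rewrite ltr0n prodn_gt0 // => i; rewrite fact_gt0.
rewrite -(pmulr_rge0 _ b0) {1}[f]mpolyE mulr_suml raddf_sum mulr_sumr /=.
have -> : \sum_(m <- msupp f)
    (\prod_(i < n) (b i)`!)%:R * (f@_m *: 'X_[m] * S ^+ N.+1)@_b =
  (N.+1)`!%:R * M%:R ^+ d * \sum_(m <- msupp f) f@_m *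
     \prod_(i < n) \prod_(k < m i) ((b i)%:R / M%:R - k%:R / M%:R).
  rewrite mulr_sumr; apply: eq_big_seq => m mf.
  have degm : mdeg m = d by exact: (dhomog_mf fhom).
  rewrite -scalerAl mcoeffZ mulrCA mcoeff_mpolyX_sumX_exp ?degm //.
  rewrite natrM natr_prod (eq_bigr _ (fun i _ => natr_ffact R M (b i) (m i) M0)).
  by rewrite big_split /= prodrXr -mdegE degm; ring.
apply/mulr_ge0; first by rewrite -natrX -natrM ler0n.
apply/ltW/NP => [|i|]; first by rewrite /M; lia.
  by rewrite divr_ge0.
by rewrite -mulr_suml -natr_sum -mdegE degb divff.
Qed.

(** * Even forms as forms in the squares of the variables *)

Definition sqrX (R : comNzRingType) n : n.-tuple {mpoly R[n]} :=
  [tuple 'X_i ^+ 2 | i < n].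

Lemma comp_sqrX_mpolyX (R : comNzRingType) n (m : 'X_{1..n}) :
  'X_[m] \mPo sqrX R n = 'X_[m] ^+ 2.
Proof.
rewrite comp_mpolyX mpolyXn mpolyXE_id; apply: eq_bigr => i _.
by rewrite tnth_mktuple mulmnE -exprM mulnC.
Qed.

Lemma even_form_comp_sqrX (R : realType) n d (p : {mpoly R[n]}) :
  even_mpoly p -> p \is d.-homog ->
  exists2 f : {mpoly R[n]}, f \is (d./2).-homog & p = f \mPo sqrX R n.
Proof.
move=> pev phom.
pose half (m : 'X_{1..n}) : 'X_{1..n} := [multinom (m i)./2 | i < n].
have halfK m : m \in msupp p -> (half m *+ 2)%MM = m.
  move=> mp; apply/mnmP => i; rewrite mulmnE mnmE.
  by have := pev m mp i; lia.
exists (\sum_(m <- msupp p) p@_m *: 'X_[half m]).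
  rewrite big_seq; apply: rpred_sum => m mp; apply: dhomogZ.
  rewrite dhomogX /=; apply/eqP.
  by have := congr1 mdeg (halfK m mp); rewrite mdegMn (dhomog_mf phom mp) /=; lia.
rewrite [LHS]mpolyE raddf_sum /=; apply: eq_big_seq => m mp.
by rewrite comp_mpolyZ comp_sqrX_mpolyX mpolyXn halfK.
Qed.

(** The substitution turns each monomial of $g$ into the square of that same
monomial, so the coefficients of $g$ serve as the weights of pure squares. *)
Lemma comp_sqrX_dsos_sdsos (R : realType) n (g : {mpoly R[n]}) :
  (forall m, 0 <= g@_m) -> dsos (g \mPo sqrX R n) /\ sdsos (g \mPo sqrX R n).
Proof.
move=> g0.
pose m (i : 'I_(size (msupp g))) := nth 0%MM (msupp g) i.
have gE : g \mPo sqrX R n = \sum_i g@_(m i) *: 'X_[m i] ^+ 2.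
  rewrite {1}[g]mpolyE raddf_sum /= (big_nth 0%MM) big_mkord.
  by apply: eq_bigr => i _; rewrite comp_mpolyZ comp_sqrX_mpolyX.
split.
- exists _, m, (fun i => g@_(m i)), (fun _ _ => 0), (fun _ _ => 0); split=> //.
  rewrite gE [X in _ + X + _]big1 ?[X in _ + X]big1 ?addr0 // => i _;
    by rewrite big1 // => j _; rewrite scale0r.
- exists _, m, (fun i => g@_(m i)), (fun _ _ => 0), (fun _ _ => 0),
    (fun _ _ => 0), (fun _ _ => 0); split=> //.
  rewrite gE [X in _ + X + _]big1 ?[X in _ + X]big1 ?addr0 // => i _;
    by rewrite big1 // => j _; rewrite !scale0r ?subr0 ?addr0 expr0n.
Qed.

Theorem theorem3p14 (R : realType) (n : nat) (p : {mpoly R[n]})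
    (p_form : is_form p) (p_even : even_mpoly p) (p_posdef : pos_def p) :
  exists r : nat, r_dsos r p /\ r_sdsos r p.
Proof.
have [d phom] := p_form.
have [f fhom pE] := @even_form_comp_sqrX R n d p p_even phom.
have fpos (x : 'I_n -> R) : (forall i, 0 <= x i) -> \sum_i x i = 1 -> 0 < f.@[x].
  move=> x0 x1; pose y : 'rV[R]_n := \row_i Num.sqrt (x i).
  have yE i : y ord0 i ^+ 2 = x i by rewrite mxE sqr_sqrtr.
  have -> : f.@[x] = p.@[y ord0].
    rewrite pE comp_mpoly_meval; apply: meval_eq => i.
    by rewrite tnth_mktuple rmorphXn /= mevalXU yE.
  apply: p_posdef; apply: contra_eq_neq x1 => y0.
  rewrite big1 ?(eq_sym 0) ?oner_neq0 // => i _.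
  by rewrite -yE y0 mxE expr0n.
have [r rP] := @polya R n _ f fhom fpos.
exists r; rewrite /r_dsos /r_sdsos.
have -> : p * (\sum_(i < n) 'X_i ^+ 2) ^+ r =
    (f * (\sum_(i < n) 'X_i) ^+ r) \mPo sqrX R n.
  rewrite rmorphM rmorphXn raddf_sum /= -pE; congr (_ * _ ^+ _).
  by apply: eq_bigr => i _; rewrite comp_mpolyXU -tnth_nth tnth_mktuple.
exact: comp_sqrX_dsos_sdsos.
Qed.
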